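(* Let $\bar x\in\{0,1\}^n$, $\bar y\in\{0,1\}^m$, $\bar z\in\{0,1\}^l$ and define $\bar{\mathcal W}=(\bar w_{ijk}):=\bar x\otimes\bar y\otimes\bar z$. Let $\mathcal G\in\{0,1\}^{n\times m\times l}$ be such that $\mathcal F\ne\emptyset$. Suppose that: 1. For each $i\in[n]$ with $\bar x_i=0$ we have $F^{x,i}>0$; for each $j\in[m]$ with $\bar y_j=0$ we have $F^{y,j}>0$; for each $k\in[l]$ with $\bar z_k=0$ we have $F^{z,k}>0$. 2. For each $i\in[n]$ with $\bar x_i=0$, $T^{x,i}_{11}>B^{x,i}$; for each $j\in[m]$ with $\bar y_j=0$, $T^{y,j}_{11}>B^{y,j}$; for each $k\in[l]$ with $\bar z_k=0$, $T^{z,k}_{11}>B^{z,k}$. 3. For each $i\in[n]$ with $\bar x_i=1$, $$\tfrac13T^{x,i}_{11}>F^{x,i}_{11}+\sum_{\substack{(j,k):(i,j,k)\in\mathcal T\\ \bar y_j=0,\ \bar z_k=1}}\frac{B^{y,j}}{T^{y,j}_{11}}+\sum_{\substack{(j,k):(i,j,k)\in\mathcal T\\ \bar y_j=1,\ \bar z_k=0}}\frac{B^{z,k}}{T^{z,k}_{11}};$$ for each $j\in[m]$ with $\bar y_j=1$, $$\tfrac13T^{y,j}_{11}>F^{y,j}_{11}+\sum_{\substack{(i,k):(i,j,k)\in\mathcal T\\ \bar x_i=0,\ \bar z_k=1}}\frac{B^{x,i}}{T^{x,i}_{11}}+\sum_{\substack{(i,k):(i,j,k)\in\mathcal T\\ \bar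 x_i=1,\ \bar z_k=0}}\frac{B^{z,k}}{T^{z,k}_{11}};$$ for each $k\in[l]$ with $\bar z_k=1$, $$\tfrac13T^{z,k}_{11}>F^{z,k}_{11}+\sum_{\substack{(i,j):(i,j,k)\in\mathcal T\\ \bar x_i=1,\ \bar y_j=0}}\frac{B^{y,j}}{T^{y,j}_{11}}+\sum_{\substack{(i,j):(i,j,k)\in\mathcal T\\ \bar x_i=0,\ \bar y_j=1}}\frac{B^{x,i}}{T^{x,i}_{11}}.$$ Then $(\bar x,\bar y,\bar z,\bar{\mathcal W})$ is the unique optimal solution of the standard LP (sLP).
   Context: Write $[n]=\{1,\dots,n\}$; $x\otimes y\otimes z$ is the tensor with $(i,j,k)$ entry $x_iy_jz_k$. For $\mathcal G=(g_{ijk})$ put $S_0=\{(i,j,k):g_{ijk}=0\}$, $S_1=\{(i,j,k):g_{ijk}=1\}$, and $$\mathcal T=\{(i,j,k)\in[n]\times[m]\times[l]:g_{ijk}=\bar x_i\bar y_j\bar z_k\},\qquad \mathcal F=\{(i,j,k)\in[n]\times[m]\times[l]:g_{ijk}=1-\bar x_i\bar y_j\bar z_k\}.$$ For $r,s\in\{0,1\}$: $T^{x,i}_{rs}$ (resp. $F^{x,i}_{rs}$) is the number of $(j,k)\in[m]\times[l]$ with $\bar y_j=r$, $\bar z_k=s$ and $(i,j,k)\in\mathcal T$ (resp. $\in\mathcal F$); $T^{y,j}_{rs}$ (resp. $F^{y,j}_{rs}$) is the number of $(i,k)\in[n]\times[l]$ with $\bar x_i=r$, $\bar z_k=s$ and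 $(i,j,k)\in\mathcal T$ (resp. $\in\mathcal F$); $T^{z,k}_{rs}$ (resp. $F^{z,k}_{rs}$) is the number of $(i,j)\in[n]\times[m]$ with $\bar x_i=r$, $\bar y_j=s$ and $(i,j,k)\in\mathcal T$ (resp. $\in\mathcal F$). For $*\in\{(x,i),(y,j),(z,k)\}$ let $F^{*}=F^{*}_{00}+F^{*}_{10}+F^{*}_{01}+F^{*}_{11}$ and, as shorthand, $$B^{*}:=\tfrac13F^{*}_{00}+\tfrac12\left(F^{*}_{01}+F^{*}_{10}\right)+F^{*}_{11}.$$ The standard LP (sLP), in variables $x\in\mathbb R^n,y\in\mathbb R^m,z\in\mathbb R^l,\mathcal W=(w_{ijk})\in\mathbb R^{n\times m\times l}$, is: minimize $\sum_{S_0}w_{ijk}+\sum_{S_1}(1-w_{ijk})$ subject to $w_{ijk}\le x_i$, $w_{ijk}\le y_j$, $w_{ijk}\le z_k$ for all $(i,j,k)\in S_1$; $w_{ijk}\ge0$, $w_{ijk}\ge x_i+y_j+z_k-2$ for all $(i,j,k)\in S_0$; and $(x,y,z)\in[0,1]^{n+m+l}$. *)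

(* Defs.v *)
(* The LP is over an arbitrary ordered field R; the classical
   statement is the case where R is the field of real numbers.  Indices run
   over 'I_n = {0, ..., n-1} instead of {1, ..., n}. *)
From HB Require Import structures.
From mathcomp Require Import all_boot all_order all_algebra.

Set Implicit Arguments.
Unset Strict Implicit.
Unset Printing Implicit Defensive.

Import Order.TTheory GRing.Theory Num.Theory.
Local Open Scope ring_scope.

Definition tensor (R : Type) (n m l : nat) : Type :=
  {ffun 'I_n * 'I_m * 'I_l -> R}.

Definition binary_vec (R : realFieldType) n (x : 'rV[R]_n) : Prop :=
  forall i, x 0 i = 0 \/ x 0 i = 1.

Definition binary_tensor (R : realFieldType) n m l (G : tensor R n m l) : Prop :=
  forall i j k, G (i, j, k) = 0 \/ G (i, j, k) = 1.

Definition outer (R : realFieldType) n m l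
    (x : 'rV[R]_n) (y : 'rV[R]_m) (z : 'rV[R]_l) : tensor R n m l :=
  [ffun t => x 0 t.1.1 * y 0 t.1.2 * z 0 t.2].

Definition S0 (R : realFieldType) n m l (G : tensor R n m l)
  : {set 'I_n * 'I_m * 'I_l} := [set t | G t == 0].

Definition S1 (R : realFieldType) n m l (G : tensor R n m l)
  : {set 'I_n * 'I_m * 'I_l} := [set t | G t == 1].

Definition calT (R : realFieldType) n m l (G : tensor R n m l)
    (x : 'rV[R]_n) (y : 'rV[R]_m) (z : 'rV[R]_l) : {set 'I_n * 'I_m * 'I_l} :=
  [set t | G t == x 0 t.1.1 * y 0 t.1.2 * z 0 t.2].

Definition calF (R : realFieldType) n m l (G : tensor R n m l)
    (x : 'rV[R]_n) (y : 'rV[R]_m) (z : 'rV[R]_l) : {set 'I_n * 'I_m * 'I_l} :=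
  [set t | G t == 1 - x 0 t.1.1 * y 0 t.1.2 * z 0 t.2].

(* Numbers of triples of A (to be taken as calT or calF) in a fixed slice of
   the tensor, sorted by the values r, s in {0, 1} of the two other vectors,
   which always appear in the order x, y, z. *)
Definition xcount (R : realFieldType) n m l (A : {set 'I_n * 'I_m * 'I_l})
    (y : 'rV[R]_m) (z : 'rV[R]_l) (i : 'I_n) (r s : nat) : nat :=
  #|[set p : 'I_m * 'I_l |
      [&& y 0 p.1 == r%:R, z 0 p.2 == s%:R & (i, p.1, p.2) \in A]]|.

Definition ycount (R : realFieldType) n m l (A : {set 'I_n * 'I_m * 'I_l})
    (x : 'rV[R]_n) (z : 'rV[R]_l) (j : 'I_m) (r s : nat) : nat :=
  #|[set p : 'I_n * 'I_l |
      [&& x 0 p.1 == r%:R, z 0 p.2 == s%:R & (p.1, j, p.2) \in A]]|.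

Definition zcount (R : realFieldType) n m l (A : {set 'I_n * 'I_m * 'I_l})
    (x : 'rV[R]_n) (y : 'rV[R]_m) (k : 'I_l) (r s : nat) : nat :=
  #|[set p : 'I_n * 'I_m |
      [&& x 0 p.1 == r%:R, y 0 p.2 == s%:R & (p.1, p.2, k) \in A]]|.

Definition sum4 (F : nat -> nat -> nat) : nat :=
  (F 0 0 + F 1 0 + F 0 1 + F 1 1)%N.

Definition wsum (R : realFieldType) (F : nat -> nat -> nat) : R :=
  3^-1 * (F 0 0)%:R + 2^-1 * ((F 0 1)%:R + (F 1 0)%:R) + (F 1 1)%:R.

Definition Tx (R : realFieldType) n m l (G : tensor R n m l)
    (x : 'rV[R]_n) (y : 'rV[R]_m) (z : 'rV[R]_l) (i : 'I_n) (r s : nat) : nat :=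
  xcount (calT G x y z) y z i r s.

Definition Ty (R : realFieldType) n m l (G : tensor R n m l)
    (x : 'rV[R]_n) (y : 'rV[R]_m) (z : 'rV[R]_l) (j : 'I_m) (r s : nat) : nat :=
  ycount (calT G x y z) x z j r s.

Definition Tz (R : realFieldType) n m l (G : tensor R n m l)
    (x : 'rV[R]_n) (y : 'rV[R]_m) (z : 'rV[R]_l) (k : 'I_l) (r s : nat) : nat :=
  zcount (calT G x y z) x y k r s.

Definition Fx (R : realFieldType) n m l (G : tensor R n m l)
    (x : 'rV[R]_n) (y : 'rV[R]_m) (z : 'rV[R]_l) (i : 'I_n) (r s : nat) : nat :=
  xcount (calF G x y z) y z i r s.

Definition Fy (R : realFieldType) n m l (G : tensor R n m l)
    (x : 'rV[R]_n) (y : 'rV[R]_m) (z : 'rV[R]_l) (j : 'I_m) (r s : nat) : nat :=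
  ycount (calF G x y z) x z j r s.

Definition Fz (R : realFieldType) n m l (G : tensor R n m l)
    (x : 'rV[R]_n) (y : 'rV[R]_m) (z : 'rV[R]_l) (k : 'I_l) (r s : nat) : nat :=
  zcount (calF G x y z) x y k r s.

Definition Bx (R : realFieldType) n m l (G : tensor R n m l)
    (x : 'rV[R]_n) (y : 'rV[R]_m) (z : 'rV[R]_l) (i : 'I_n) : R :=
  wsum R (Fx G x y z i).

Definition By (R : realFieldType) n m l (G : tensor R n m l)
    (x : 'rV[R]_n) (y : 'rV[R]_m) (z : 'rV[R]_l) (j : 'I_m) : R :=
  wsum R (Fy G x y z j).

Definition Bz (R : realFieldType) n m l (G : tensor R n m l)
    (x : 'rV[R]_n) (y : 'rV[R]_m) (z : 'rV[R]_l) (k : 'I_l) : R :=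
  wsum R (Fz G x y z k).

Definition lp_point (R : realFieldType) (n m l : nat) : Type :=
  ('rV[R]_n * 'rV[R]_m * 'rV[R]_l * tensor R n m l)%type.

Definition slp_obj (R : realFieldType) n m l (G : tensor R n m l)
    (p : lp_point R n m l) : R :=
  let: (x, y, z, W) := p in
  \sum_(t in S0 G) W t + \sum_(t in S1 G) (1 - W t).

Definition slp_feasible (R : realFieldType) n m l (G : tensor R n m l)
    (p : lp_point R n m l) : Prop :=
  let: (x, y, z, W) := p in
  [/\ forall i j k, (i, j, k) \in S1 G ->
        [/\ W (i, j, k) <= x 0 i, W (i, j, k) <= y 0 j & W (i, j, k) <= z 0 k],
      forall i j k, (i, j, k) \in S0 G ->
        0 <= W (i, j, k) /\ x 0 i + y 0 j + z 0 k - 2 <= W (i, j, k)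
    & [/\ forall i, 0 <= x 0 i <= 1,
          forall j, 0 <= y 0 j <= 1
        & forall k, 0 <= z 0 k <= 1]].

Definition slp_optimal (R : realFieldType) n m l (G : tensor R n m l)
    (p : lp_point R n m l) : Prop :=
  slp_feasible G p /\
  forall q : lp_point R n m l, slp_feasible G q -> slp_obj G p <= slp_obj G q.

(* Main.v *)
Require Import Defs.
From HB Require Import structures.
From mathcomp Require Import all_boot all_order all_algebra.
From mathcomp Require Import lra.
Set Implicit Arguments.
Unset Strict Implicit.
Unset Printing Implicit Defensive.
Import Order.TTheory GRing.Theory Num.Theory.
Local Open Scope ring_scope.

(** The proof is linear programming duality, with the dual certificate written
    as a family of inequalities, one per entry of the tensor.

    Measure a feasible point by its deviations dx_i = |x'_i - x_i|, dy_j, dz_k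
    from the binary vectors.  At an entry t = (i, j, k) the cost of the point
    exceeds the cost of the outer product by at least a linear form
    a_t dx_i + b_t dy_j + c_t dz_k ([entry_boundP]):
    - t in T, x_i = y_j = z_k = 1: the excess 1 - w is at least each of the
      three deviations, hence at least their mean;
    - t in T, exactly one coordinate 0, say x_i: the excess w is at least 0 and
      at least dx_i - dy_j - dz_k, hence at least lx_i times the latter for
      any multiplier lx_i between 0 and 1;
    - t in T, several coordinates 0: the excess is at least 0;
    - t in F, x_i = y_j = z_k = 1: the excess w - 1 is at least
      - (dx_i + dy_j + dz_k);
    - t in F, some coordinates 0: the excess is - w, and w is at most each
      deviation of a zero coordinate, hence at most their mean.

    Add these up and collect the coefficient of each deviation: it is a sum of
    weights over one slice of the tensor.  With lx_i = B^{x,i} / T^{x,i}_11 the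
    coefficient of dx_i vanishes when x_i = 0 ([slice_weight0]), and when
    x_i = 1 it is the difference of the two sides of the third hypothesis
    ([slice_weight1]), hence positive.  So the total excess is nonnegative.

    If the total excess is zero, the positive coefficients force x', y', z' to
    agree with the binary vectors wherever these are 1, and every entry
    inequality is tight.  Where x_i = 0, the second hypothesis gives
    lx_i < 1 and an entry of T with y_j = z_k = 1; there tightness reads
    lx_i dx_i = w >= dx_i, so dx_i = 0.  Once all deviations vanish, tightness
    says that each entry costs exactly what it does for the outer product,
    and the cost of an entry determines it. *)

(** * The bound for a single entry *)

Definition entry_cost (R : realFieldType) (g w : R) : R :=
  if g == 1 then 1 - w else w.

Definition entry_feasible (R : realFieldType) (g x y z w : R) : Prop :=
  (g = 1 -> [/\ w <= x, w <= y & w <= z]) /\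
  (g = 0 -> 0 <= w /\ x + y + z - 2 <= w).

(** The coefficient of the deviation of the coordinate [a] in the bound of an
    entry whose other two coordinates are [b] and [c]; [ok] says that the entry
    lies in T, and [la], [lb], [lc] are the multipliers of the three
    coordinates.  Singling out [a] lets the same function serve for
    the three directions of the tensor, by permuting its arguments. *)
Definition weight (R : realFieldType) (ok : bool) (a b c la lb lc : R) : R :=
  if ok then
    if a == 1 then
      if b == 1 then (if c == 1 then 3^-1 else - lc)
      else (if c == 1 then - lb else 0)
    else if (b == 1) && (c == 1) then la else 0
  else
    if a == 1 then (if (b == 1) && (c == 1) then - 1 else 0)
    else if (b == 1) && (c == 1) then - 1
    else if (b == 1) || (c == 1) then - 2^-1 else - 3^-1.

Definition entry_bound (R : realFieldType) (ok : bool)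
    (a b c x y z la lb lc : R) : R :=
  `|x - a| * weight ok a b c la lb lc
  + `|y - b| * weight ok b a c lb la lc
  + `|z - c| * weight ok c a b lc la lb.

Lemma eq01 (R : realFieldType) : ((0 : R) == 1) = false.
Proof. by rewrite eq_sym oner_eq0. Qed.

Lemma deviation0 (R : realFieldType) (x : R) : 0 <= x <= 1 -> `|x - 0| = x.
Proof. by case/andP => x_ge0 _; rewrite subr0 ger0_norm. Qed.

Lemma deviation1 (R : realFieldType) (x : R) : 0 <= x <= 1 -> `|x - 1| = 1 - x.
Proof. by case/andP => _ x_le1; rewrite distrC ger0_norm ?subr_ge0. Qed.

(** Interpolates between the two lower bounds that the LP imposes on an entry
    outside the support of G. *)
Lemma scaled_le (R : realFieldType) (la e w : R) :
  0 <= la <= 1 -> 0 <= w -> e <= w -> la * e <= w.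
Proof.
case/andP=> la_ge0 la_le1 w_ge0 le_ew.
apply: (le_trans (ler_wpM2l la_ge0 le_ew)).
exact: ler_piMl.
Qed.

(** This inequality is dual feasibility of the certificate: each case is a
    nonnegative combination of the constraints of the LP at one entry. *)
Lemma entry_boundP (R : realFieldType) (g a b c x y z w la lb lc : R) :
    g = 0 \/ g = 1 -> a = 0 \/ a = 1 -> b = 0 \/ b = 1 -> c = 0 \/ c = 1 ->
    0 <= x <= 1 -> 0 <= y <= 1 -> 0 <= z <= 1 ->
    (a = 0 -> 0 <= la <= 1) -> (b = 0 -> 0 <= lb <= 1) ->
    (c = 0 -> 0 <= lc <= 1) ->
    entry_feasible g x y z w ->
  entry_bound (g == a * b * c) a b c x y z la lb lc
    <= entry_cost g w - entry_cost g (a * b * c).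
Proof.
move=> gE aE bE cE x01 y01 z01 la01 lb01 lc01 [feas1 feas0].
rewrite /entry_bound /entry_cost /weight.
case: gE => g_eq; rewrite {}g_eq in feas0 feas1 *;
  [have {feas0 feas1} [w_ge0 w_ge] := feas0 erefl
  |have {feas0 feas1} [w_le_x w_le_y w_le_z] := feas1 erefl];
case: aE => a_eq; rewrite {}a_eq in la01 *;
case: bE => b_eq; rewrite {}b_eq in lb01 *;
case: cE => c_eq; rewrite {}c_eq in lc01 *;
rewrite ?(deviation0 x01, deviation1 x01, deviation0 y01, deviation1 y01,
          deviation0 z01, deviation1 z01);
rewrite ?(mulr0, mul0r, mulr1, eqxx, eq01, oner_eq0) /=;
try lra.
(* The entries of T with exactly one zero coordinate, where the bound is a
   product and needs the interpolation. *)
- have := scaled_le (la01 erefl) w_ge0 w_ge; lra.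
- have := scaled_le (lb01 erefl) w_ge0 w_ge; lra.
- have := scaled_le (lc01 erefl) w_ge0 w_ge; lra.
Qed.

(** * Summation of the weights over a slice *)

Definition slice_count (R : realFieldType) (J K : finType)
    (b : J -> R) (c : K -> R) (A : pred (J * K)) (r s : nat) : nat :=
  #|[set p : J * K | [&& b p.1 == r%:R, c p.2 == s%:R & A p]]|.

Lemma natr_card_set (R : realFieldType) (T : finType) (A : pred T) :
  (#|[set p | A p]|)%:R = \sum_p (A p)%:R :> R.
Proof.
rewrite cardsE -sum1_card natr_sum big_mkcond; apply: eq_bigr => p _.
by rewrite unfold_in; case: (A p).
Qed.

(** In a slice at a zero coordinate only the (1, 1) entries of T gain, at rate
    [la]; the entries of F lose 1/3, 1/2 or 1 according to how many zero
    coordinates share the loss, and these are the coefficients of B. *)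
Lemma slice_weight0 (R : realFieldType) (J K : finType)
    (b : J -> R) (c : K -> R) (T F : pred (J * K))
    (la : R) (lb : J -> R) (lc : K -> R) :
    (forall j, b j = 0 \/ b j = 1) -> (forall k, c k = 0 \/ c k = 1) ->
    (forall p, F p = ~~ T p) ->
  \sum_p weight (T p) 0 (b p.1) (c p.2) la (lb p.1) (lc p.2) =
  la * (slice_count b c T 1 1)%:R - wsum R (slice_count b c F).
Proof.
move=> bE cE FE; rewrite /wsum /slice_count !natr_card_set.
rewrite -big_split /= !mulr_sumr -!big_split -sumrB /=.
apply: eq_bigr => -[j k] _ /=; rewrite FE /weight eq01.
by case: (bE j) => ->; case: (cE k) => ->; case: (T _);
   rewrite ?(eqxx, eq01, oner_eq0) /=; lra.
Qed.

(** In a slice at a coordinate equal to 1, the two sums collect the entries of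
    T with exactly one zero coordinate: the multiplier there belongs to
    that zero coordinate and is charged to the deviation of this one. *)
Lemma slice_weight1 (R : realFieldType) (J K : finType)
    (b : J -> R) (c : K -> R) (T F : pred (J * K))
    (la : R) (lb : J -> R) (lc : K -> R) :
    (forall j, b j = 0 \/ b j = 1) -> (forall k, c k = 0 \/ c k = 1) ->
    (forall p, F p = ~~ T p) ->
  \sum_p weight (T p) 1 (b p.1) (c p.2) la (lb p.1) (lc p.2) =
  3^-1 * (slice_count b c T 1 1)%:R
  - ((slice_count b c F 1 1)%:R
     + \sum_(p | [&& T p, b p.1 == 0 & c p.2 == 1]) lb p.1
     + \sum_(p | [&& T p, b p.1 == 1 & c p.2 == 0]) lc p.2).
Proof.
move=> bE cE FE; rewrite /slice_count !natr_card_set.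
rewrite !(big_mkcond (fun _ => [&& _, _ & _])).
rewrite !mulr_sumr -!big_split -sumrB /=.
apply: eq_bigr => -[j k] _ /=; rewrite FE /weight eqxx.
by case: (bE j) => ->; case: (cE k) => ->; case: (T _);
   rewrite ?(eqxx, eq01, oner_eq0) /=; lra.
Qed.

(** The multiplier B / T_11 is the one that balances gains and losses at a
    zero coordinate; the inequality B < T_11 keeps it strictly below 1,
    which is what later forces uniqueness at that coordinate.  The last
    conclusion supplies the entry of T at which this strictness is used. *)
Lemma slice_certificate (R : realFieldType) (J K : finType)
    (a : R) (b : J -> R) (c : K -> R) (T F : pred (J * K))
    (la : R) (lb : J -> R) (lc : K -> R) :
    a = 0 \/ a = 1 ->
    (forall j, b j = 0 \/ b j = 1) -> (forall k, c k = 0 \/ c k = 1) ->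
    (forall p, F p = ~~ T p) ->
    la = wsum R (slice_count b c F) / (slice_count b c T 1 1)%:R ->
    (a = 0 -> wsum R (slice_count b c F) < (slice_count b c T 1 1)%:R) ->
    (a = 1 -> (slice_count b c F 1 1)%:R
              + \sum_(p | [&& T p, b p.1 == 0 & c p.2 == 1]) lb p.1
              + \sum_(p | [&& T p, b p.1 == 1 & c p.2 == 0]) lc p.2
              < 3^-1 * (slice_count b c T 1 1)%:R) ->
  let w := \sum_p weight (T p) a (b p.1) (c p.2) la (lb p.1) (lc p.2) in
  [/\ 0 <= w, a = 1 -> 0 < w, a = 0 -> 0 <= la < 1
    & a = 0 -> exists2 p, b p.1 = 1 /\ c p.2 = 1 & T p].
Proof.
move=> aE bE cE FE laE lt0 lt1 w.
have B_ge0 : 0 <= wsum R (slice_count b c F).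
  by rewrite /wsum !addr_ge0 ?mulr_ge0 ?invr_ge0 ?addr_ge0 ?ler0n.
case: aE => a_eq; rewrite {}a_eq in lt0 lt1 w *; last first.
  have w_gt0 : 0 < w.
    by rewrite /w (slice_weight1 la lb lc bE cE FE) subr_gt0 lt1.
  by split=> [|//||]; [exact: ltW | move/eqP; rewrite oner_eq0..].
have {lt0 lt1} ltBT := lt0 erefl.
have T_gt0 := le_lt_trans B_ge0 ltBT.
split=> [|/esym/eqP|_|_]; last 1 first.
- move: T_gt0; rewrite ltr0n => /card_gt0P[p].
  by rewrite inE => /and3P[/eqP bp /eqP cp Tp]; exists p.
- by rewrite /w (slice_weight0 la lb lc bE cE FE) laE divfK ?subrr ?gt_eqF.
- by rewrite oner_eq0.
- by rewrite laE divr_ge0 ?(ltW T_gt0) //= ltr_pdivrMr ?mul1r.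
Qed.

(** * From the slices to the whole linear program *)

(** Collects the coefficient of [f i] in a sum over triples, [h i] being the
    parametrization of the slice at [i] by the pairs of remaining indices. *)
Lemma sum_fibers (R : realFieldType) (I P Q : finType) (h : I -> P -> Q)
    (f : I -> R) (g : Q -> R) (k : Q -> I) :
    bijective (fun ip => h ip.1 ip.2) -> (forall i p, k (h i p) = i) ->
  \sum_t f (k t) * g t = \sum_i f i * \sum_p g (h i p).
Proof.
move=> h_bij kE; rewrite (reindex _ (onW_bij _ h_bij)) /=.
rewrite -(pair_bigA _ (fun i p => f (k (h i p)) * g (h i p))) /=.
apply: eq_bigr => i _; rewrite mulr_sumr.
by apply: eq_bigr => p _; rewrite kE.
Qed.

Lemma slp_obj_entries (R : realFieldType) n m l (G : tensor R n m l)
    x y z (W : tensor R n m l) :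
    binary_tensor G ->
  slp_obj G (x, y, z, W) = \sum_t entry_cost (G t) (W t).
Proof.
move=> G_bin; rewrite /slp_obj big_mkcond [X in _ + X]big_mkcond -big_split /=.
apply: eq_bigr => -[[i j] k] _; rewrite !inE /entry_cost.
by case: (G_bin i j k) => ->; rewrite ?(eqxx, eq01, oner_eq0) ?addr0 ?add0r.
Qed.

Lemma slp_feasible_entries (R : realFieldType) n m l (G : tensor R n m l)
    x y z (W : tensor R n m l) :
  slp_feasible G (x, y, z, W) <->
  (forall i j k,
     entry_feasible (G (i, j, k)) (x 0 i) (y 0 j) (z 0 k) (W (i, j, k))) /\
  [/\ forall i, 0 <= x 0 i <= 1, forall j, 0 <= y 0 j <= 1
    & forall k, 0 <= z 0 k <= 1].
Proof.
split=> [[f1 f0 box]|[f box]]; split=> // i j k; first split=> g.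
- by apply: f1; rewrite inE g.
- by apply: f0; rewrite inE g.
- by rewrite inE => /eqP g; apply: (f i j k).1.
- by rewrite inE => /eqP g; apply: (f i j k).2.
Qed.

Lemma outer_feasible (R : realFieldType) n m l (x : 'rV[R]_n) (y : 'rV[R]_m)
    (z : 'rV[R]_l) (G : tensor R n m l) :
    binary_vec x -> binary_vec y -> binary_vec z ->
  slp_feasible G (x, y, z, outer x y z).
Proof.
have box p (v : 'rV[R]_p) : binary_vec v -> forall i, 0 <= v 0 i <= 1.
  by move=> v_bin i; case: (v_bin i) => ->; rewrite lexx ler01.
move=> x_bin y_bin z_bin; apply/slp_feasible_entries.
split; last by split; exact: box.
move=> i j k; rewrite ffunE /=.
by case: (x_bin i) => ->; case: (y_bin j) => ->; case: (z_bin k) => ->;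
  split=> _; split; lra.
Qed.

Lemma calF_notT (R : realFieldType) n m l (x : 'rV[R]_n) (y : 'rV[R]_m)
    (z : 'rV[R]_l) (G : tensor R n m l) :
    binary_vec x -> binary_vec y -> binary_vec z -> binary_tensor G ->
  forall i j k, ((i, j, k) \in calF G x y z) = ((i, j, k) \notin calT G x y z).
Proof.
move=> x_bin y_bin z_bin G_bin i j k; rewrite !inE /=.
by case: (x_bin i) => ->; case: (y_bin j) => ->; case: (z_bin k) => ->;
   case: (G_bin i j k) => ->;
   rewrite ?(mulr0, mul0r, mulr1, subr0, subrr, eqxx, eq01, oner_eq0).
Qed.

(** The weights [wx], [wy], [wz] are the coefficients of the deviations in the
    summed entry bounds, so nonnegativity of all of them gives optimality.
    Uniqueness needs strictness: positive weights settle the coordinates equal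
    to 1, and multipliers below 1 settle the coordinates equal to 0. *)
Lemma certificate_unique_optimum (R : realFieldType) (n m l : nat)
    (x : 'rV[R]_n) (y : 'rV[R]_m) (z : 'rV[R]_l) (G : tensor R n m l)
    (lx : 'I_n -> R) (ly : 'I_m -> R) (lz : 'I_l -> R)
    (T := calT G x y z)
    (wx := fun i => \sum_(p : 'I_m * 'I_l) weight ((i, p.1, p.2) \in T)
             (x 0 i) (y 0 p.1) (z 0 p.2) (lx i) (ly p.1) (lz p.2))
    (wy := fun j => \sum_(p : 'I_n * 'I_l) weight ((p.1, j, p.2) \in T)
             (y 0 j) (x 0 p.1) (z 0 p.2) (ly j) (lx p.1) (lz p.2))
    (wz := fun k => \sum_(p : 'I_n * 'I_m) weight ((p.1, p.2, k) \in T)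
             (z 0 k) (x 0 p.1) (y 0 p.2) (lz k) (lx p.1) (ly p.2)) :
    binary_vec x -> binary_vec y -> binary_vec z -> binary_tensor G ->
    (forall i, [/\ 0 <= wx i, x 0 i = 1 -> 0 < wx i, x 0 i = 0 -> 0 <= lx i < 1
       & x 0 i = 0 -> exists2 p : 'I_m * 'I_l,
           y 0 p.1 = 1 /\ z 0 p.2 = 1 & (i, p.1, p.2) \in T]) ->
    (forall j, [/\ 0 <= wy j, y 0 j = 1 -> 0 < wy j, y 0 j = 0 -> 0 <= ly j < 1
       & y 0 j = 0 -> exists2 p : 'I_n * 'I_l,
           x 0 p.1 = 1 /\ z 0 p.2 = 1 & (p.1, j, p.2) \in T]) ->
    (forall k, [/\ 0 <= wz k, z 0 k = 1 -> 0 < wz k, z 0 k = 0 -> 0 <= lz k < 1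
       & z 0 k = 0 -> exists2 p : 'I_n * 'I_m,
           x 0 p.1 = 1 /\ y 0 p.2 = 1 & (p.1, p.2, k) \in T]) ->
  slp_optimal G (x, y, z, outer x y z) /\
  forall q : lp_point R n m l, slp_optimal G q -> q = (x, y, z, outer x y z).
Proof.
move=> x_bin y_bin z_bin G_bin Hx Hy Hz.
have p_feas : slp_feasible G (x, y, z, outer x y z) by exact: outer_feasible.
have ltW01 (s : R) : 0 <= s < 1 -> 0 <= s <= 1 by case/andP=> -> /ltW ->.
pose gap (W : tensor R n m l) t :=
  entry_cost (G t) (W t) - entry_cost (G t) (outer x y z t).
pose bound (x' : 'rV[R]_n) (y' : 'rV[R]_m) (z' : 'rV[R]_l) t :=
  entry_bound (t \in T) (x 0 t.1.1) (y 0 t.1.2) (z 0 t.2)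
    (x' 0 t.1.1) (y' 0 t.1.2) (z' 0 t.2) (lx t.1.1) (ly t.1.2) (lz t.2).
have bound_sum x' y' z' : \sum_t bound x' y' z' t =
    \sum_i `|x' 0 i - x 0 i| * wx i + \sum_j `|y' 0 j - y 0 j| * wy j
    + \sum_k `|z' 0 k - z 0 k| * wz k.
  rewrite /bound /entry_bound !big_split /=; congr (_ + _ + _).
  - apply: (@sum_fibers _ _ _ _ (fun i (p : 'I_m * 'I_l) => (i, p.1, p.2))
      (fun i => `|x' 0 i - x 0 i|) (fun t => weight (t \in T) (x 0 t.1.1)
        (y 0 t.1.2) (z 0 t.2) (lx t.1.1) (ly t.1.2) (lz t.2))
      (fun t => t.1.1)) => //.
    by exists (fun t => (t.1.1, (t.1.2, t.2))) => [[i [j k]]|[[i j] k]].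
  - apply: (@sum_fibers _ _ _ _ (fun j (p : 'I_n * 'I_l) => (p.1, j, p.2))
      (fun j => `|y' 0 j - y 0 j|) (fun t => weight (t \in T) (y 0 t.1.2)
        (x 0 t.1.1) (z 0 t.2) (ly t.1.2) (lx t.1.1) (lz t.2))
      (fun t => t.1.2)) => //.
    by exists (fun t => (t.1.2, (t.1.1, t.2))) => [[j [i k]]|[[i j] k]].
  - apply: (@sum_fibers _ _ _ _ (fun k (p : 'I_n * 'I_m) => (p.1, p.2, k))
      (fun k => `|z' 0 k - z 0 k|) (fun t => weight (t \in T) (z 0 t.2)
        (x 0 t.1.1) (y 0 t.1.2) (lz t.2) (lx t.1.1) (ly t.1.2))
      (fun t => t.2)) => //.
    by exists (fun t => (t.2, (t.1.1, t.1.2))) => [[k [i j]]|[[i j] k]].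
have x_ge0 (x' : 'rV[R]_n) i : 0 <= `|x' 0 i - x 0 i| * wx i.
  by rewrite mulr_ge0 //; case: (Hx i).
have y_ge0 (y' : 'rV[R]_m) j : 0 <= `|y' 0 j - y 0 j| * wy j.
  by rewrite mulr_ge0 //; case: (Hy j).
have z_ge0 (z' : 'rV[R]_l) k : 0 <= `|z' 0 k - z 0 k| * wz k.
  by rewrite mulr_ge0 //; case: (Hz k).
have gap_ge x' y' z' W : slp_feasible G (x', y', z', W) ->
    forall t, bound x' y' z' t <= gap W t.
  move=> /slp_feasible_entries[feas [boxx boxy boxz]] [[i j] k].
  rewrite /bound /gap /T inE /= ffunE /=.
  apply: entry_boundP => //.
  - by case: (Hx i) => _ _ H _ /H /ltW01.
  - by case: (Hy j) => _ _ H _ /H /ltW01.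
  - by case: (Hz k) => _ _ H _ /H /ltW01.
have gap_sum x' y' z' W : \sum_t gap W t =
    slp_obj G (x', y', z', W) - slp_obj G (x, y, z, outer x y z).
  by rewrite !slp_obj_entries // -sumrB.
have p_opt : slp_optimal G (x, y, z, outer x y z).
  split=> // -[[[x' y'] z'] W] q_feas; rewrite -subr_ge0 -gap_sum.
  apply: le_trans (ler_sum _ (fun t _ => gap_ge _ _ _ _ q_feas t)).
  by rewrite bound_sum !addr_ge0 ?sumr_ge0.
split=> // -[[[x' y'] z'] W] [q_feas q_min].
have gap_le0 : \sum_t gap W t <= 0.
  by rewrite (gap_sum x' y' z') subr_le0 q_min.
have slack_ge0 t : 0 <= gap W t - bound x' y' z' t by rewrite subr_ge0 gap_ge.
have slack_sum : \sum_t (gap W t - bound x' y' z' t)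
   = \sum_t gap W t - \sum_t bound x' y' z' t by rewrite sumrB.
rewrite bound_sum in slack_sum.
have slacks_ge0 : 0 <= \sum_t (gap W t - bound x' y' z' t) by exact: sumr_ge0.
have sx_ge0 : 0 <= \sum_i `|x' 0 i - x 0 i| * wx i by exact: sumr_ge0.
have sy_ge0 : 0 <= \sum_j `|y' 0 j - y 0 j| * wy j by exact: sumr_ge0.
have sz_ge0 : 0 <= \sum_k `|z' 0 k - z 0 k| * wz k by exact: sumr_ge0.
have /(psumr_eq0P (fun t _ => slack_ge0 t)) slack0 :
  \sum_t (gap W t - bound x' y' z' t) = 0 by lra.
have /(psumr_eq0P (fun i _ => x_ge0 x' i)) x0 :
  \sum_i `|x' 0 i - x 0 i| * wx i = 0 by lra.
have /(psumr_eq0P (fun i _ => y_ge0 y' i)) y0 :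
  \sum_j `|y' 0 j - y 0 j| * wy j = 0 by lra.
have /(psumr_eq0P (fun i _ => z_ge0 z' i)) z0 :
  \sum_k `|z' 0 k - z 0 k| * wz k = 0 by lra.
(* Coordinates equal to 1 first: the argument for a zero coordinate uses an
   entry whose other two coordinates equal 1 and have no deviation left. *)
have dev0 (d w : R) : d * w = 0 -> 0 < w -> d = 0.
  by move=> /eqP + /gt_eqF w0; rewrite mulf_eq0 w0 orbF => /eqP.
have x1E i : x 0 i = 1 -> x' 0 i = x 0 i.
  case: (Hx i) => _ H _ _ /H /(dev0 _ _ (x0 i isT))/eqP.
  by rewrite normr_eq0 subr_eq0 => /eqP.
have y1E j : y 0 j = 1 -> y' 0 j = y 0 j.
  case: (Hy j) => _ H _ _ /H /(dev0 _ _ (y0 j isT))/eqP.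
  by rewrite normr_eq0 subr_eq0 => /eqP.
have z1E k : z 0 k = 1 -> z' 0 k = z 0 k.
  case: (Hz k) => _ H _ _ /H /(dev0 _ _ (z0 k isT))/eqP.
  by rewrite normr_eq0 subr_eq0 => /eqP.
case/slp_feasible_entries: (q_feas) => feas [boxx boxy boxz].
(* At an entry where both G and the outer product vanish, the gap is the entry
   of W itself, so tightness turns the LP constraint on W into a constraint on
   the bound. *)
have gap_tight i j k : (i, j, k) \in T ->
    x 0 i * y 0 j * z 0 k = 0 ->
    x' 0 i + y' 0 j + z' 0 k - 2 <= bound x' y' z' (i, j, k).
  move=> t_T p0; have /eqP := slack0 (i, j, k) isT; rewrite subr_eq0 => /eqP <-.
  move: t_T; rewrite inE /gap ffunE /= p0 => /eqP g0.
  rewrite /entry_cost g0 eq01 subr0.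
  by case: (feas i j k) => _ /(_ g0)[].
have xE i : x' 0 i = x 0 i.
  have [xi|/x1E //] := x_bin i.
  have [_ _ /(_ xi)/andP[_ lt1] /(_ xi)[[j k] /= [yj zk] t_T]] := Hx i.
  have := gap_tight _ _ _ t_T; rewrite xi !mul0r => /(_ erefl).
  rewrite /bound /entry_bound /= t_T (y1E _ yj) (z1E _ zk) xi yj zk.
  rewrite !subrr normr0 !mul0r !addr0 /weight eq01 eqxx /=.
  rewrite (deviation0 (boxx i)).
  have /andP[x'_ge0 _] := boxx i; nra.
have yE j : y' 0 j = y 0 j.
  have [yj|/y1E //] := y_bin j.
  have [_ _ /(_ yj)/andP[_ lt1] /(_ yj)[[i k] /= [xi zk] t_T]] := Hy j.
  have := gap_tight _ _ _ t_T; rewrite yj mulr0 mul0r => /(_ erefl).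
  rewrite /bound /entry_bound /= t_T (x1E _ xi) (z1E _ zk) xi yj zk.
  rewrite !subrr normr0 !mul0r !addr0 !add0r /weight eq01 eqxx /=.
  rewrite (deviation0 (boxy j)).
  have /andP[y'_ge0 _] := boxy j; nra.
have zE k : z' 0 k = z 0 k.
  have [zk|/z1E //] := z_bin k.
  have [_ _ /(_ zk)/andP[_ lt1] /(_ zk)[[i j] /= [xi yj] t_T]] := Hz k.
  have := gap_tight _ _ _ t_T; rewrite zk mulr0 => /(_ erefl).
  rewrite /bound /entry_bound /= t_T (x1E _ xi) (y1E _ yj) xi yj zk.
  rewrite !subrr normr0 !mul0r !add0r /weight eq01 eqxx /=.
  rewrite (deviation0 (boxz k)).
  have /andP[z'_ge0 _] := boxz k; nra.
congr (_, _, _, _); [by apply/rowP | by apply/rowP | by apply/rowP |].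
apply/ffunP => t; have := slack0 t isT.
(* With no deviation the bound is 0, so W has the cost of the outer product at
   each entry. *)
rewrite /bound /entry_bound xE yE zE !subrr normr0 !mul0r !addr0 subr0.
by rewrite /gap /entry_cost; case: ifP => _; lra.
Qed.

Theorem proposition9 (R : realFieldType) (n m l : nat)
    (x : 'rV[R]_n) (y : 'rV[R]_m) (z : 'rV[R]_l) (G : tensor R n m l)
    (x_bin : binary_vec x) (y_bin : binary_vec y) (z_bin : binary_vec z)
    (G_bin : binary_tensor G)
    (F_neq0 : calF G x y z != set0)
    (h1x : forall i, x 0 i = 0 -> (0 < sum4 (Fx G x y z i))%N)
    (h1y : forall j, y 0 j = 0 -> (0 < sum4 (Fy G x y z j))%N)
    (h1z : forall k, z 0 k = 0 -> (0 < sum4 (Fz G x y z k))%N)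
    (h2x : forall i, x 0 i = 0 -> Bx G x y z i < (Tx G x y z i 1 1)%:R)
    (h2y : forall j, y 0 j = 0 -> By G x y z j < (Ty G x y z j 1 1)%:R)
    (h2z : forall k, z 0 k = 0 -> Bz G x y z k < (Tz G x y z k 1 1)%:R)
    (h3x : forall i, x 0 i = 1 ->
      (Fx G x y z i 1 1)%:R
      + \sum_(p : 'I_m * 'I_l | [&& (i, p.1, p.2) \in calT G x y z,
                                    y 0 p.1 == 0 & z 0 p.2 == 1])
          By G x y z p.1 / (Ty G x y z p.1 1 1)%:R
      + \sum_(p : 'I_m * 'I_l | [&& (i, p.1, p.2) \in calT G x y z,
                                    y 0 p.1 == 1 & z 0 p.2 == 0])
          Bz G x y z p.2 / (Tz G x y z p.2 1 1)%:R
      < 3^-1 * (Tx G x y z i 1 1)%:R)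
    (h3y : forall j, y 0 j = 1 ->
      (Fy G x y z j 1 1)%:R
      + \sum_(p : 'I_n * 'I_l | [&& (p.1, j, p.2) \in calT G x y z,
                                    x 0 p.1 == 0 & z 0 p.2 == 1])
          Bx G x y z p.1 / (Tx G x y z p.1 1 1)%:R
      + \sum_(p : 'I_n * 'I_l | [&& (p.1, j, p.2) \in calT G x y z,
                                    x 0 p.1 == 1 & z 0 p.2 == 0])
          Bz G x y z p.2 / (Tz G x y z p.2 1 1)%:R
      < 3^-1 * (Ty G x y z j 1 1)%:R)
    (h3z : forall k, z 0 k = 1 ->
      (Fz G x y z k 1 1)%:R
      + \sum_(p : 'I_n * 'I_m | [&& (p.1, p.2, k) \in calT G x y z,
                                    x 0 p.1 == 1 & y 0 p.2 == 0])
          By G x y z p.2 / (Ty G x y z p.2 1 1)%:R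
      + \sum_(p : 'I_n * 'I_m | [&& (p.1, p.2, k) \in calT G x y z,
                                    x 0 p.1 == 0 & y 0 p.2 == 1])
          Bx G x y z p.1 / (Tx G x y z p.1 1 1)%:R
      < 3^-1 * (Tz G x y z k 1 1)%:R) :
  slp_optimal G (x, y, z, outer x y z) /\
  forall q : lp_point R n m l, slp_optimal G q -> q = (x, y, z, outer x y z).


Proof.
have FE := calF_notT x_bin y_bin z_bin G_bin.
pose lx i := Bx G x y z i / (Tx G x y z i 1 1)%:R.
pose ly j := By G x y z j / (Ty G x y z j 1 1)%:R.
pose lz k := Bz G x y z k / (Tz G x y z k 1 1)%:R.
apply: (@certificate_unique_optimum _ _ _ _ _ _ _ _ lx ly lz) => // [i|j|k].
- apply: (@slice_certificate R 'I_m 'I_l (x 0 i) (y 0) (z 0)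
    (fun p => (i, p.1, p.2) \in calT G x y z)
    (fun p => (i, p.1, p.2) \in calF G x y z) (lx i) ly lz) => //.
  + exact: h2x.
  + exact: h3x.
- apply: (@slice_certificate R 'I_n 'I_l (y 0 j) (x 0) (z 0)
    (fun p => (p.1, j, p.2) \in calT G x y z)
    (fun p => (p.1, j, p.2) \in calF G x y z) (ly j) lx lz) => //.
  + exact: h2y.
  + exact: h3y.
- apply: (@slice_certificate R 'I_n 'I_m (z 0 k) (x 0) (y 0)
    (fun p => (p.1, p.2, k) \in calT G x y z)
    (fun p => (p.1, p.2, k) \in calF G x y z) (lz k) lx ly) => //.
  + exact: h2z.
  + by move=> zk; rewrite addrAC; exact: h3z.
Qed.
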